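(* For any $n\geqslant 2$ and any nonzero polynomial vector field $\delta\in W_n$ on $\mathbb{C}^n$ with non-constant divergence, there exists a complete vector field $D\in W_n$ such that $W_n$ is generated, as a Lie algebra over $\mathbb{C}$, by $\delta$ and $D$.
   Context: The ground field is $\mathbb{C}$. $W_n = \mathrm{Vec}(\mathbb{A}^n)$ is the complex Lie algebra of polynomial vector fields $f_1\partial_{x_1}+\ldots+f_n\partial_{x_n}$ on $\mathbb{C}^n$ with $f_1,\ldots,f_n\in\mathbb{C}[x_1,\ldots,x_n]$ (equivalently, all $\mathbb{C}$-derivations of $\mathbb{C}[x_1,\ldots,x_n]$), with the commutator bracket, i.e. $[f\partial_{x_i}, g\partial_{x_j}] = f\frac{\partial g}{\partial x_i}\partial_{x_j} - g\frac{\partial f}{\partial x_j}\partial_{x_i}$. The divergence is $\operatorname{div}(f_1\partial_{x_1}+\ldots+f_n\partial_{x_n}) = \frac{\partial f_1}{\partial x_1}+\ldots+\frac{\partial f_n}{\partial x_n}$; it is non-constant if it does not lie in $\mathbb{C}$. A vector field $\delta\in W_n$ is complete if its flow map is well-defined for all complex times, i.e. for every $p\in\mathbb{C}^n$ there is a holomorphic map $\gamma:\mathbb{C}\to\mathbb{C}^n$ with $\gamma(0)=p$ and $\dot\gamma(s)$ equal to the value of $\delta$ at $\gamma(s)$ for all $s\in\mathbb{C}$. A subset $S$ generates a Lie algebra $\mathcal{L}$ if the smallest Lie subalgebra of $\mathcal{L}$ containing $S$ is $\mathcal{L}$. *)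

(* Defs.v *)
From HB Require Import structures.
From mathcomp Require Import all_boot all_order all_algebra.
From mathcomp Require Import complex.
From mathcomp Require Import boolp classical_sets reals topology normedtype derive.
(* mpoly and MathComp-Analysis have conflicting notations. *)
From mathcomp Require Import -(notations) mpoly.

Set Implicit Arguments.
Unset Strict Implicit.
Unset Printing Implicit Defensive.

Import GRing.Theory.
Import numFieldNormedType.Exports.
Local Open Scope ring_scope.
Local Open Scope classical_set_scope.

Section PolynomialVectorFields.
Variables (K : fieldType) (n : nat).

(* [d : vecfield] stands for \sum_i d i * \partial_{x_i}. *)
Definition vecfield := {ffun 'I_n -> mpoly n K}.

Definition vf_apply (d : vecfield) (p : mpoly n K) : mpoly n K :=
  \sum_(i < n) d i * mderiv i p.

(* Commutator of derivations: its j-th coefficient is its value at x_j. *)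
Definition vf_bracket (d e : vecfield) : vecfield :=
  [ffun j => vf_apply d (e j) - vf_apply e (d j)].

Definition vf_div (d : vecfield) : mpoly n K := \sum_(i < n) mderiv i (d i).

Definition lie_subalgebra (S : set vecfield) : Prop :=
  [/\ S 0,
      forall u v, S u -> S v -> S (u + v),
      forall (c : K) u, S u -> S (c *: u)
    & forall u v, S u -> S v -> S (vf_bracket u v)].

Definition generates_W (A : set vecfield) : Prop :=
  smallest lie_subalgebra A = [set: vecfield].

End PolynomialVectorFields.

(* [C^o] is [C] as a normed space over itself, so that the derivative in
   direction 1 is the complex derivative. *)
Definition complete_vf (R : realType) (n : nat) (d : vecfield R[i] n) : Prop :=
  forall p : 'I_n -> R[i],
  exists gamma : R[i] -> 'I_n -> R[i],
    (forall j, gamma 0 j = p j) /\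
    (forall (s : R[i]) (j : 'I_n),
       is_derive (s : R[i]^o) (1 : R[i]^o) (fun t : R[i]^o => gamma t j : R[i]^o)
         (meval (gamma s) (d j))).

(* Main.v *)
Require Import Defs.
From HB Require Import structures.
From mathcomp Require Import all_boot all_order all_algebra.
From mathcomp Require Import complex.
From mathcomp Require Import boolp classical_sets reals topology normedtype derive.
From mathcomp Require Import -(notations) mpoly.
From mathcomp Require Import ring lra zify.
From mathcomp Require Import functions sequences exp trigo.
Local Open Scope ring_scope.
Local Open Scope classical_set_scope.

Set Implicit Arguments.
Unset Strict Implicit.
Unset Printing Implicit Defensive.
Import Order.TTheory GRing.Theory Num.Theory.
Import numFieldNormedType.Exports.

(** The complete field is a conjugate, under a polynomial automorphism of the
    affine space, of a linear diagonal field $\sum_i \lambda_i x_i \partial_i$.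
    Both completeness and the generation property are carried along by
    conjugation, so instead of moving the diagonal field one may put [delta]
    in a convenient position and then use the diagonal field itself.

    Suppose first that the constant term, the $x_j$ and the $x_j^2$
    coefficients of the $i$-th component of [delta] are nonzero for all
    $i \ne j$.  Bracketing with the diagonal field multiplies the monomial
    field $x^m \partial_j$ by the weight $\sum_l \lambda_l m_l - \lambda_j$.
    If $x_i$ does not divide $x^b$, then the exponent vector $b - e_i$ of
    $x^b \partial_i$ determines $b$ and $i$ (its only negative entry is at
    $i$); hence for generic $\lambda$ the weight of $x^b \partial_i$ occurs
    only once in [delta], and $x^b \partial_i$ is extracted by an
    interpolation polynomial in the bracket operator ([weight_extraction],
    [separating_weights]).  This puts $\partial_i$, $x_j \partial_i$ and
    $x_j^2 \partial_i$ in the subalgebra for all $i \ne j$.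

    These fields generate all divergence-free fields.  The latter are spanned
    by the fields $\partial_j f\,\partial_i - \partial_i f\,\partial_j$
    ([ham_field], [div_free_mem]), on which a shear field $q \partial_i$ with
    $\partial_i q = 0$ acts by $f \mapsto q\,\partial_i f$ ([ham_shear]); an
    induction on the exponent reaches every monomial $f$
    ([ham_monomial_mem]).  The divergences of the elements of the subalgebra
    are then stable under divergence-free derivations, and contain the
    nonconstant divergence of [delta]; such a space contains a coordinate,
    hence every polynomial, and the subalgebra is everything
    ([generation_from_shears]).

    It remains to reach the convenient position ([reduce_to_generic]).
    Conjugation by a shear $x_i \mapsto x_i + c\,x_k^N$ is polynomial in the
    parameter $c$, so it preserves finitely many given non-vanishing
    conditions for all but finitely many $c$.  Its first-order term in the
    $i$-th component is $N x_k^{N-1} \delta_k - x_k^N \partial_i \delta_i$,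
    which for $N = 3$ or $N = 4$ makes $\partial_k^2 \delta_i$ nonzero as soon as
    $\delta_k \ne 0$ ([curve_by_shear]).
    Iterating over all pairs makes every $\partial_k^2 \delta_i$ with
    $i \ne k$ a nonzero polynomial, and a translation to a point where the
    relevant derivatives do not vanish finishes the reduction.  Shears and
    translations preserve the divergence up to substitution. *)

(** * Derivations and Hamiltonian fields *)

Section Algebra.
Variables (K : fieldType) (n : nat).
Hypothesis char0 : [pchar K] =i pred0.
Implicit Types (i j k l : 'I_n) (p q f : mpoly n K) (m a b : multinom n).
Implicit Types (u v w d e : vecfield K n) (h g : 'I_n -> mpoly n K) (lam : 'I_n -> K).
Local Notation mX i := (mpolyX K (mnm1 i)).

Let natr_eq0 r : (r%:R == 0 :> K) = (r == 0)%N.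
Proof. by move: r; apply/pcharf0P. Qed.

(** Identities between algebra morphisms or derivations need checking on the
    coordinates only. *)
Lemma mpoly_alg_ind (P : mpoly n K -> Prop) :
  (forall c, P (mpolyC n c)) -> (forall i, P (mX i)) ->
  (forall p q, P p -> P q -> P (p + q)) ->
  (forall p q, P p -> P q -> P (p * q)) -> forall p, P p.
Proof.
move=> PC PX PD PM; apply: mpolyind => [|c m p _ _ Pp]; first by rewrite -mpolyC0.
apply: PD => //; rewrite -mul_mpolyC; apply: (PM) => //.
rewrite mpolyXE_id; apply: (big_ind P) => [||i _]; [by rewrite -mpolyC1|exact: PM|].
elim: (m i) => [|r IH]; first by rewrite expr0 -mpolyC1.
by rewrite exprS; apply: PM.
Qed.

Lemma mderiv_mX i j : mderiv i (mX j) = (j == i)%:R.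
Proof.
rewrite mderivX mnm1E; case: eqP => [->|_]; last by rewrite scale0r.
by rewrite scale1r -mpolyX0; congr mpolyX; apply/mnmP => l; rewrite mnmBE mnm0E subnn.
Qed.

Lemma vf_applyD d : {morph vf_apply d : p q / p + q}.
Proof.
move=> p q; rewrite /vf_apply -big_split; apply: eq_bigr => i _.
by rewrite mderivD mulrDr.
Qed.

Lemma vf_applyZ d c p : vf_apply d (c *: p) = c *: vf_apply d p.
Proof. by rewrite /vf_apply scaler_sumr; apply: eq_bigr => i _; rewrite mderivZ -scalerAr. Qed.

Lemma vf_apply0 d : vf_apply d 0 = 0.
Proof. by rewrite /vf_apply big1 // => i _; rewrite mderiv0 mulr0. Qed.

Lemma vf_applyC d c : vf_apply d (mpolyC n c) = 0.
Proof. by rewrite /vf_apply big1 // => i _; rewrite mderivC mulr0. Qed.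

Lemma vf_applyM d p q : vf_apply d (p * q) = vf_apply d p * q + p * vf_apply d q.
Proof.
rewrite /vf_apply mulr_suml mulr_sumr -big_split; apply: eq_bigr => i _.
by rewrite mderivM /=; ring.
Qed.

Lemma vf_apply_mX d i : vf_apply d (mX i) = d i.
Proof.
rewrite /vf_apply (bigD1 i) //= mderiv_mX eqxx mulr1 big1 ?addr0 // => j ji.
by rewrite mderiv_mX eq_sym (negPf ji) mulr0.
Qed.

Definition coord_field i p : vecfield K n := [ffun j => if j == i then p else 0].

(** The contraction of the closed form $df$ with the bivector
    $\partial_i \wedge \partial_j$, up to sign: in the plane of the two
    coordinates it is the Hamiltonian field of [f], the other coordinates being
    parameters. *)
Definition ham_field i j f : vecfield K n :=
  coord_field i (mderiv j f) - coord_field j (mderiv i f).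

Lemma vf_apply_coord_field i p q : vf_apply (coord_field i p) q = p * mderiv i q.
Proof.
rewrite /vf_apply (bigD1 i) //= ffunE eqxx big1 ?addr0 // => j /negPf ji.
by rewrite ffunE ji mul0r.
Qed.

Lemma vf_applyBl d e p : vf_apply (d - e) p = vf_apply d p - vf_apply e p.
Proof. by rewrite /vf_apply -sumrB; apply: eq_bigr => i _; rewrite !ffunE mulrBl. Qed.

Lemma coord_fieldD i p q : coord_field i (p + q) = coord_field i p + coord_field i q.
Proof. by apply/ffunP => k; rewrite !ffunE; case: eqP => // _; rewrite addr0. Qed.

Lemma coord_fieldZ i c p : coord_field i (c *: p) = c *: coord_field i p.
Proof. by apply/ffunP => k; rewrite !ffunE; case: eqP => // _; rewrite scaler0. Qed.

Lemma hamD i j f f' : ham_field i j (f + f') = ham_field i j f + ham_field i j f'.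
Proof. by rewrite /ham_field !mderivD !coord_fieldD opprD addrACA. Qed.

Lemma hamZ i j c f : ham_field i j (c *: f) = c *: ham_field i j f.
Proof. by rewrite /ham_field !mderivZ !coord_fieldZ scalerBr. Qed.

Lemma hamC i j f : ham_field j i f = - ham_field i j f.
Proof. by rewrite /ham_field opprB. Qed.

(** A shear field commutes with $\partial_j$ up to a multiple of $\partial_i$,
    so it preserves the bivector $\partial_i \wedge \partial_j$ and acts only on
    the coefficient [f]. *)
Lemma ham_shear i j q f : i != j -> mderiv i q = 0 ->
  vf_bracket (coord_field i q) (ham_field i j f) = ham_field i j (q * mderiv i f).
Proof.
move=> ij qi; apply/ffunP => k; rewrite [LHS]ffunE vf_apply_coord_field {2}/ham_field vf_applyBl.
rewrite !vf_apply_coord_field /ham_field !ffunE !(fun_if (mderiv _)) mderiv0.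
have [->|ki] := eqVneq k i.
  by rewrite (negPf ij) !subr0 qi mulr0 mderivM (mderiv_comm i j); ring.
rewrite !mderiv0 !mulr0 subrr subr0 !sub0r; case: eqP => _; last by rewrite oppr0 mderiv0 mulr0.
by rewrite mderivN mderivM qi mulrN mul0r add0r.
Qed.

(** Mixed partial derivatives commute. *)
Lemma div_ham i j f : vf_div (ham_field i j f) = 0.
Proof.
rewrite /vf_div.
transitivity (\sum_k (mderiv k (coord_field i (mderiv j f) k) -
  mderiv k (coord_field j (mderiv i f) k))).
  by apply: eq_bigr => k _; rewrite !ffunE mderivB.
rewrite sumrB (bigD1 i) //= [X in _ - X](bigD1 j) //= !ffunE !eqxx !big1 ?addr0.
- by rewrite mderiv_comm subrr.
- by move=> k /negPf kj; rewrite ffunE kj mderiv0.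
- by move=> k /negPf kj; rewrite ffunE kj mderiv0.
Qed.

Lemma leq_mdeg_pair i j a : i != j -> (a i + a j <= mdeg a)%N.
Proof.
by move=> ij; rewrite mdegE (bigD1 i) //= (bigD1 j) ?(eq_sym j i) //= addnA leq_addr.
Qed.

(** * Shear fields of degree at most two generate the divergence-free fields *)

Section Subalgebra.
Variable L : set (vecfield K n).
Hypothesis subL : lie_subalgebra L.

Let L0 : L 0. Proof. by case: subL. Qed.
Let LD u v : L u -> L v -> L (u + v). Proof. by case: subL => _ h _ _; apply: h. Qed.
Let LZ c u : L u -> L (c *: u). Proof. by case: subL => _ _ h _; apply: h. Qed.
Let LN u : L u -> L (- u). Proof. by rewrite -scaleN1r; apply: LZ. Qed.
Let Lbr u v : L u -> L v -> L (vf_bracket u v). Proof. by case: subL => _ _ _ h; apply: h. Qed.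

Hypothesis shearL : forall i j r, i != j -> (r <= 2)%N -> L (coord_field i (mX j ^+ r)).

Lemma mderiv_mXn i j r : i != j -> mderiv i (mX j ^+ r) = 0.
Proof.
move=> ij; rewrite mpolyXn mderivX mulmnE mnm1E eq_sym (negPf ij) mul0n scale0r //.
Qed.

(** The shear $x_l^r \partial_i$ maps $x^{a + e_i - r e_l}$ to a nonzero
    multiple of $x^a$; the case $l = j$ is included. *)
Lemma ham_monomial_step i j l r a : i != j -> l != i -> (r <= 2)%N -> (r <= a l)%N ->
  L (ham_field i j (mpolyX K (mnm_sub (mnm_add a (mnm1 i)) (mnm_muln (mnm1 l) r)))) ->
  L (ham_field i j (mpolyX K a)).
Proof.
move=> ij li r2 ral; set a' := mnm_sub _ _ => La.
have il : i != l by rewrite eq_sym.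
have := Lbr (shearL il r2) La; rewrite ham_shear ?mderiv_mXn //.
have a'i : a' i = (a i).+1 by rewrite mnmBE mnmDE mulmnE !mnm1E eqxx (negPf li) mul0n subn0 addn1.
rewrite mpolyXn mderivX a'i -scalerAr -mpolyXD hamZ => /(LZ ((a i).+1%:R^-1)).
rewrite scalerA mulVf ?natr_eq0 // scale1r; set b := mnm_add _ _.
suff -> : b = a by [].
apply/mnmP => k; rewrite mnmDE !mnmBE mnmDE !mulmnE !mnm1E.
have [?|lk] := eqVneq l k; first by subst k; rewrite (negPf il) /=; lia.
by case: eqP => _; lia.
Qed.

(** The field is $-r x_i^{r-1} \partial_j$, a multiple of a given shear. *)
Lemma ham_power_mem i j r : i != j -> (r <= 2)%N -> L (ham_field i j (mX i ^+ r)).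
Proof.
move=> ij r2; rewrite /ham_field mpolyXn !mderivX mulmnE mnm1E (negPf ij) mul0n scale0r.
have -> : coord_field i 0 = 0 by apply/ffunP => k; rewrite !ffunE if_same.
rewrite sub0r coord_fieldZ; apply/LN/LZ.
case: r r2 => [|r] r2.
  rewrite mulm0n; have -> : mnm_sub mnm0 (mnm1 i) = mnm_muln (mnm1 i) 0.
    by apply/mnmP => k; rewrite mnmBE mulm0n mnm0E.
  by rewrite -mpolyXn; apply: shearL; rewrite // eq_sym.
rewrite mulmSr addmK -mpolyXn; apply: shearL; [by rewrite eq_sym|exact: ltnW].
Qed.

Lemma ham_monomial_base i j a : i != j -> (forall l, l != i -> l != j -> a l = 0%N) ->
  a j = 0%N -> (a i <= 2)%N -> L (ham_field i j (mpolyX K a)).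
Proof.
move=> ij a0 aj ai; have := ham_power_mem ij ai; rewrite mpolyXn; set b := mnm_muln _ _.
suff -> : b = a by [].
apply/mnmP => k; rewrite mulmnE mnm1E; have [<-|ik] := eqVneq i k; first by rewrite mul1n.
by rewrite mul0n; have [->//|kj] := eqVneq k j; rewrite a0 // eq_sym.
Qed.

(** Write $\mu(a) = 2 \deg a - a_i - a_j$.  Trading a variable outside the
    $(i,j)$-plane for $x_i$, or $x_j^2$ for $x_i$, or $x_i^2$ for $x_j$, lowers
    $\mu$ by one; when no such trade is possible the monomial divides
    $x_i x_j$. *)
Lemma ham_monomial_mem i j a : i != j -> L (ham_field i j (mpolyX K a)).
Proof.
(* [N0] bounds $\mu(a)$; the subtracted terms stand on the right because
   subtraction is truncated. *)
move=> ij; move: {2}(mdeg a + mdeg a)%N (leqnn (mdeg a + mdeg a)) => N0 h0.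
have {h0} : (mdeg a + mdeg a <= N0 + a i + a j)%N by lia.
elim: N0 => [|N IH] in i j a ij *.
all: have ji : j != i by [rewrite eq_sym].
  move=> h; have := leq_mdeg_pair a ij => h1.
  have e : forall l, a l = 0%N.
    have : mdeg a == 0%N by lia.
    by rewrite mdeg_eq0 => /eqP -> l; rewrite mnm0E.
  by apply: ham_monomial_base; rewrite ?e.
have mono l k r : (r <= a l)%N -> l != k ->
   (mdeg (mnm_sub (mnm_add a (mnm1 k)) (mnm_muln (mnm1 l) r)) + r = (mdeg a).+1)%N.
  move=> ral lk.
  have /(congr1 mdeg) : mnm_add (mnm_sub (mnm_add a (mnm1 k)) (mnm_muln (mnm1 l) r))
      (mnm_muln (mnm1 l) r) = mnm_add a (mnm1 k).
    apply: submK; apply/mnm_lepP => x; rewrite mnmDE mulmnE !mnm1E.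
    by case: eqP => [<-|_]; lia.
  by rewrite !mdegD mdegMn !mdeg1 mul1n addn1.
have val l k r x : mnm_sub (mnm_add a (mnm1 k)) (mnm_muln (mnm1 l) r) x =
    (a x + (k == x) - (l == x) * r)%N by rewrite mnmBE mnmDE mulmnE !mnm1E.
move=> h.
case: (boolP [exists l, [&& l != i, l != j & (0 < a l)%N]]) => [/existsP[l /and3P[li lj al]]|].
  apply: (@ham_monomial_step i j l 1) => //; apply: IH => //.
  have := mono l i 1%N al li; rewrite !val eqxx (negPf li) (negPf lj) (negPf ij) /=; lia.
move=> /existsPn out0.
have a0 l : l != i -> l != j -> a l = 0%N.
  by move=> li lj; have := out0 l; rewrite li lj /= -leqNgt leqn0 => /eqP.
have [aj2|aj2] := leqP 2 (a j).
  apply: (@ham_monomial_step i j j 2) => //; apply: IH => //.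
  have := mono j i 2%N aj2 ji; rewrite !val !eqxx (negPf ij) (negPf ji) /=; lia.
have [ai2|ai2] := leqP 2 (a i).
  rewrite hamC; apply: LN.
  apply: (@ham_monomial_step j i i 2) => //; apply: IH => //.
  have := mono i j 2%N ai2 ij; rewrite !val !eqxx (negPf ij) (negPf ji) /=; lia.
(* What is left is $x_i^{a_i}$, or $x_i x_j$, which comes from $x_i^2$. *)
have [aj0|aj1] := posnP (a j); first by apply: ham_monomial_base => //; apply: ltnW.
apply: (@ham_monomial_step i j j 1) => //; apply: ham_monomial_base => //.
- by move=> l li lj; rewrite val a0 // ![_ == l]eq_sym (negPf li) (negPf lj).
- rewrite val eqxx (negPf ij) /=; lia.
- rewrite val eqxx (negPf ji) /=; lia.
Qed.

Lemma ham_mem i j f : i != j -> L (ham_field i j f).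
Proof.
move=> ij; move: f; apply: mpolyind => [|c a f _ _ Lf].
  by have := hamZ i j 0 0; rewrite !scale0r => ->.
by rewrite hamD hamZ; apply: LD => //; apply/LZ/ham_monomial_mem.
Qed.

End Subalgebra.

Definition antideriv i p : mpoly n K :=
  \sum_(m <- msupp p) (mcoeff m p / (m i).+1%:R) *: mpolyX K (mnm_add m (mnm1 i)).

Lemma antiderivK i p : mderiv i (antideriv i p) = p.
Proof.
rewrite raddf_sum [RHS]mpolyE; apply: eq_bigr => m _ /=.
rewrite mderivZ mderivX scalerA mnmDE mnm1E eqxx addn1 addmK.
by rewrite -mulrA mulVf ?mulr1 // natr_eq0.
Qed.

Lemma mderiv_msupp0 i p m : mderiv i p = 0 -> m \in msupp p -> m i = 0%N.
Proof.
move=> di; rewrite mcoeff_msupp; apply: contraNeq => mi.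
have := mcoeff_mderiv i p (mnm_sub m (mnm1 i)); rewrite di mcoeff0.
have -> : mnm_add (mnm_sub m (mnm1 i)) (mnm1 i) = m.
  by apply/submK/mnm_lepP => k; rewrite mnm1E; case: eqP => [<-|//]; rewrite lt0n.
by move/esym/eqP; rewrite -mulr_natr mulf_eq0 natr_eq0 /= orbF.
Qed.

Lemma mderiv_antideriv0 i j p : i != j -> mderiv i p = 0 -> mderiv i (antideriv j p) = 0.
Proof.
move=> ij di; rewrite raddf_sum big_seq big1 // => m /(mderiv_msupp0 di) mi /=.
by rewrite mderivZ mderivX mnmDE mi mnm1E eq_sym (negPf ij) scale0r scaler0.
Qed.

Lemma mderiv_eq0_constant p : (forall i, mderiv i p = 0) -> exists c, p = mpolyC n c.
Proof.
move=> d0; exists (mcoeff mnm0 p); apply/mpolyP => m; rewrite mcoeffC.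
have [->|m0] := eqVneq m mnm0; first by rewrite mulr1.
rewrite mulr0; apply: memN_msupp_eq0; apply: contra m0 => mp.
by apply/eqP/mnmP => i; rewrite mnm0E; apply: mderiv_msupp0 mp.
Qed.

(** For inductions on a polynomial through its derivatives. *)
Lemma msize_mderiv i p : p != 0 -> (mmeasure mdeg (mderiv i p) < mmeasure mdeg p)%N.
Proof.
move=> p0; rewrite -[X in (_ < X)%N]prednK; last by rewrite lt0n msize_poly_eq0.
rewrite ltnS msizeE big_seq; apply/bigmax_leqP_seq => m mp _.
have : mnm_add m (mnm1 i) \in msupp p.
  move: mp; rewrite !mcoeff_msupp mcoeff_mderiv; by apply: contraNneq => ->; rewrite mul0rn.
by move=> /msize_mdeg_lt; rewrite mdegD mdeg1 addn1 => h; rewrite -ltnS prednK // (leq_trans _ h).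
Qed.

Lemma vf_divD u v : vf_div (u + v) = vf_div u + vf_div v.
Proof. by rewrite /vf_div -big_split; apply: eq_bigr => i _; rewrite ffunE mderivD. Qed.

Lemma vf_divZ c u : vf_div (c *: u) = c *: vf_div u.
Proof. by rewrite /vf_div scaler_sumr; apply: eq_bigr => i _; rewrite ffunE mderivZ. Qed.

Lemma vf_divB u v : vf_div (u - v) = vf_div u - vf_div v.
Proof. by rewrite -scaleN1r vf_divD vf_divZ scaleN1r. Qed.

Lemma vf_div_coord_field i p : vf_div (coord_field i p) = mderiv i p.
Proof.
rewrite /vf_div (bigD1 i) //= ffunE eqxx big1 ?addr0 // => j /negPf ji.
by rewrite ffunE ji mderiv0.
Qed.

(** The second-order terms $\partial_j u_i\,\partial_i v_j$ of the two halves of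
    the bracket are exchanged by swapping the indices, and cancel. *)
Lemma vf_div_bracket u v :
  vf_div (vf_bracket u v) = vf_apply u (vf_div v) - vf_apply v (vf_div u).
Proof.
have aux d e : \sum_j mderiv j (vf_apply d (e j)) =
    vf_apply d (vf_div e) + \sum_j \sum_i mderiv j (d i) * mderiv i (e j).
  rewrite /vf_div (big_morph _ (vf_applyD d) (vf_apply0 d)) -big_split; apply: eq_bigr => j _ /=.
  rewrite /vf_apply raddf_sum -big_split; apply: eq_bigr => i _ /=.
  by rewrite mderivM mderiv_comm addrC.
transitivity (\sum_j mderiv j (vf_apply u (v j)) - \sum_j mderiv j (vf_apply v (u j))).
  by rewrite -sumrB; apply: eq_bigr => j _; rewrite ffunE mderivB.
rewrite !aux [X in _ + X - _]exchange_big /=.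
set A := (X in _ + X - _); set B := (X in _ - (_ + X)).
have -> : A = B by apply: eq_bigr => i _; apply: eq_bigr => j _; rewrite mulrC.
by rewrite opprD addrACA subrr addr0.
Qed.

Definition nonconstant_div d := ~ (exists c, vf_div d = mpolyC n c).

Section Generation.
Variable L : set (vecfield K n).
Hypotheses (subL : lie_subalgebra L) (n2 : (2 <= n)%N).
Hypothesis shearL : forall i j r, i != j -> (r <= 2)%N -> L (coord_field i (mX j ^+ r)).

Let LD u v : L u -> L v -> L (u + v). Proof. by case: subL => _ h _ _; apply: h. Qed.
Let LZ c u : L u -> L (c *: u). Proof. by case: subL => _ _ h _; apply: h. Qed.

Lemma exists_neq i : exists j : 'I_n, j != i.
Proof.
have [i0|i0] := eqVneq (i : nat) 0%N.
  by exists (Ordinal n2); rewrite -val_eqE /= i0.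
by exists (Ordinal (ltnW n2)); rewrite -val_eqE /= eq_sym.
Qed.

(** Subtracting from [u] suitable Hamiltonian fields of the $(i, i_0)$-planes
    kills all components but the $i_0$-th; as the divergence is zero, the
    remaining component is independent of $x_{i_0}$, and such a shear field is Hamiltonian in any
    plane that contains the $x_{i_0}$-axis. *)
Lemma div_free_mem u : vf_div u = 0 -> L u.
Proof.
move=> du.
have [L0 _ _ _] := subL.
pose i0 := Ordinal (ltnW n2); have [j0 ji] := exists_neq i0.
pose s := \sum_(i < n | i != i0) ham_field i i0 (antideriv i0 (u i)).
have Ls : L s by apply: (big_ind L) => // i ii0; apply: ham_mem.
have ds : vf_div s = 0.
  apply: (big_ind (fun v => vf_div v = 0)) => [|v w hv hw|i _]; last exact: div_ham.
    by have := vf_divZ 0 0; rewrite !scale0r.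
  by rewrite vf_divD hv hw addr0.
have e : u - s = coord_field i0 ((u - s) i0).
  apply/ffunP => k; rewrite [RHS]ffunE; have [->//|ki] := eqVneq k i0.
  rewrite !ffunE sum_ffunE (bigD1 k) //= big1 ?addr0.
    by rewrite !ffunE eqxx (negPf ki) subr0 antiderivK subrr.
  move=> i /andP[ii0 ik]; rewrite !ffunE (negPf ki) eq_sym (negPf ik).
  by rewrite subrr.
have e2 : mderiv i0 ((u - s) i0) = 0 by rewrite -vf_div_coord_field -e vf_divB du ds subrr.
suff : L (u - s) by move=> /(LD Ls); rewrite addrC subrK.
rewrite e; have -> : coord_field i0 ((u - s) i0) = ham_field i0 j0 (antideriv j0 ((u - s) i0)).
  rewrite /ham_field antiderivK mderiv_antideriv0 // 1?eq_sym //.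
  by apply/ffunP => k; rewrite !ffunE !if_same subr0.
by apply: ham_mem; rewrite // eq_sym.
Qed.

(** The set [P] of divergences of elements of [L] is a module over the
    divergence-free fields.  Repeated differentiation of a nonconstant
    element of [P] produces [f] with $\partial_i f$ a nonzero constant;
    $x_k \partial_i$ turns it into $x_k$, which the Hamiltonian fields of a
    plane containing the $x_k$-axis map onto all polynomials.  As [L] contains
    all divergence-free fields, it contains every field. *)
Lemma generation_from_shears d : L d -> nonconstant_div d -> forall v, L v.
Proof.
move=> Ld dnc.
pose P f := exists2 u, L u & vf_div u = f.
have Papply v f : vf_div v = 0 -> P f -> P (vf_apply v f).
  move=> dv [u Lu <-]; exists (vf_bracket v u).
    by have [_ _ _ h] := subL; apply: h => //; apply: div_free_mem.
  have h0 w : vf_apply w 0 = 0 := vf_apply0 w.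
  by rewrite vf_div_bracket dv h0 subr0.
have PZ c f : P f -> P (c *: f).
  by move=> [u Lu <-]; exists (c *: u); rewrite ?vf_divZ //; apply: LZ.
have Pd i f : P f -> P (mderiv i f).
  move=> /(@Papply (coord_field i 1)); rewrite vf_div_coord_field vf_apply_coord_field mul1r.
  by apply; rewrite -mpolyC1 mderivC.
have [i [f [c [c0 Pf fi]]]] : exists i f c, [/\ c != 0, P f & mderiv i f = mpolyC n c].
  have : P (vf_div d) by exists d.
  move: dnc; rewrite /nonconstant_div; move: (vf_div d) => f.
  have [N] := ubnP (mmeasure mdeg f); elim: N => // N IH in f * => fN fnc Pf.
  have [i fi] : exists i, mderiv i f != 0.
    apply/existsP; apply: contra_notT fnc => /existsPn h.
    by apply: mderiv_eq0_constant => i; apply/eqP; rewrite -[_ == _]negbK h.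
  case: (pselect (exists c, mderiv i f = mpolyC n c)) => [[c fc]|fic].
    by exists i, f, c; split=> //; move: fi; rewrite fc mpolyC_eq0.
  apply: (IH (mderiv i f)) => //; last exact: Pd.
  have f0 : f != 0 by apply: contraNneq fi => ->; rewrite mderiv0.
  by apply: leq_trans (msize_mderiv i f0) _; rewrite -ltnS.
have [k ki] := exists_neq i; have [j jk] := exists_neq k.
have Pk : P (mX k).
  have : P (vf_apply (coord_field i (mX k)) f).
    by apply: Papply => //; rewrite vf_div_coord_field mderiv_mX (negPf ki).
  rewrite vf_apply_coord_field fi => /(PZ c^-1).
  by rewrite mulrC mul_mpolyC scalerA mulVf // scale1r.
have Pall r : P r.
  rewrite -(antiderivK j r).
  have := @Papply (ham_field k j (antideriv j r)) _ (div_ham _ _ _) Pk.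
  by rewrite vf_apply_mX !ffunE eqxx eq_sym (negPf jk) subr0.
move=> v; have [u Lu du] := Pall (vf_div v).
suff : L (v - u) by move=> /(LD Lu); rewrite addrC subrK.
by apply: div_free_mem; rewrite vf_divB du subrr.
Qed.

End Generation.

(** * Non-vanishing of polynomials over an infinite field *)

Lemma eq_natr r s : (r%:R == s%:R :> K) = (r == s)%N.
Proof.
wlog sr : r s / (s <= r)%N.
  by move=> h; case: (leqP s r) => [/h //|/ltnW /h]; rewrite eq_sym => ->; rewrite eq_sym.
by rewrite -subr_eq0 -natrB // natr_eq0 subn_eq0 eqn_leq sr andbT.
Qed.

(** Stated for an arbitrary derivation [D] along an arbitrary ring morphism, so
    as to cover partial derivatives of substitutions, derivatives in an
    auxiliary parameter, and abstract derivations. *)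
Lemma chain_rule (S : comNzRingType) (phi : {rmorphism mpoly n K -> S}) (D : S -> S) :
  {morph D : x y / x + y} -> (forall x y, D (x * y) = D x * y + x * D y) ->
  (forall c, D (phi (mpolyC n c)) = 0) ->
  forall p, D (phi p) = \sum_i phi (mderiv i p) * D (phi (mX i)).
Proof.
move=> DD DM DC; apply: mpoly_alg_ind => [c|k|p q hp hq|p q hp hq].
- by rewrite DC big1 // => i _; rewrite mderivC rmorph0 mul0r.
- rewrite (bigD1 k) //= mderiv_mX eqxx rmorph1 mul1r big1 ?addr0 // => i /negPf ik.
  by rewrite mderiv_mX eq_sym ik rmorph0 mul0r.
- by rewrite rmorphD DD hp hq -big_split; apply: eq_bigr => i _; rewrite mderivD rmorphD mulrDl.
- rewrite rmorphM DM hp hq mulr_suml mulr_sumr -big_split; apply: eq_bigr => i _ /=.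
  by rewrite mderivM rmorphD !rmorphM; ring.
Qed.

(** The images of the naturals give more points than the polynomial can have
    roots. *)
Lemma poly_nonroot (P : {poly K}) : P != 0 -> exists t, P.[t] != 0.
Proof.
move=> P0; apply: contrapT => h; pose rs : seq K := [seq (r%:R : K) | r <- iota 0 (size P)].
have rootP : all (root P) rs.
  by apply/allP => x _; apply/eqP; apply: contrapT => /eqP Px; apply: h; exists x.
have uniq_rs : uniq rs.
  by rewrite map_inj_uniq ?iota_uniq // => x y /eqP; rewrite eq_natr => /eqP.
by have := max_poly_roots P0 rootP uniq_rs; rewrite size_map size_iota ltnn.
Qed.

(** If [p] vanishes everywhere then so does its restriction to every line
    parallel to an axis, hence so do its partial derivatives; by induction on
    the size these are zero, and [p] is a constant. *)
Lemma mpoly_nonroot p : p != 0 -> exists x, meval x p != 0.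
Proof.
move=> p0; apply: contrapT => h.
have {h} : forall x, meval x p = 0.
  by move=> x; apply/eqP; apply: contrapT => /negP px; apply: h; exists x.
move: p0; have [N] := ubnP (mmeasure mdeg p); elim: N => // N IH in p * => pN p0 px.
have dp0 i x : meval x (mderiv i p) = 0.
  pose line k : {poly K} := (x k)%:P + (k == i)%:R *: 'X.
  pose phi := mmap (@polyC K) line.
  have phiE q t : (phi q).[t] = meval (fun k => x k + (k == i)%:R * t) q.
    move: q; apply: mpoly_alg_ind => [c|k|q r hq hr|q r hq hr].
    - by rewrite /phi mmapC mevalC hornerC.
    - by rewrite /phi mmapX mmap1U mevalXU /line !hornerE.
    - by rewrite /phi rmorphD mevalD -hq -hr hornerD.
    - by rewrite /phi rmorphM mevalM -hq -hr hornerM.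
  have phip : phi p = 0.
    apply/eqP; apply: contrapT => /negP/poly_nonroot[t]; by rewrite phiE px eqxx.
  have dC c : deriv (phi (mpolyC n c)) = 0 by rewrite /phi mmapC derivC.
  have : deriv (phi p) = \sum_k phi (mderiv k p) * deriv (phi (mX k)).
    exact: (chain_rule (@derivD _) (@derivM _) dC).
  rewrite phip deriv0 (bigD1 i) //= big1 => [|k /negPf ki]; last first.
    by rewrite {2}/phi mmapX mmap1U /line ki scale0r addr0 derivC mulr0.
  rewrite {2}/phi mmapX mmap1U /line eqxx scale1r derivD derivC derivX add0r mulr1 addr0.
  move=> /esym/(congr1 (horner^~ 0)); rewrite phiE horner0 => <-.
  by apply: meval_eq => k; rewrite mulr0 addr0.
have dz i : mderiv i p = 0.
  apply/eqP; apply: contrapT => /negP d0.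
  by have := IH _ (leq_trans (msize_mderiv i p0) pN) d0 (dp0 i).
have [c pc] := mderiv_eq0_constant dz.
by move: p0 (px (fun=> 0)); rewrite pc mevalC mpolyC_eq0 => /eqP.
Qed.

(** * Extraction of monomial fields by a diagonal field *)

Definition diag_field lam : vecfield K n := [ffun i => lam i *: mX i].

(** The eigenvalue of $x^m \partial_j$ under bracketing with the diagonal
    field. *)
Definition weight lam m j := \sum_l lam l * (m l)%:R - lam j.

Lemma mcoeff_diag_apply lam p m :
  mcoeff m (vf_apply (diag_field lam) p) = (\sum_l lam l * (m l)%:R) * mcoeff m p.
Proof.
have aux a : vf_apply (diag_field lam) (mpolyX K a) = (\sum_l lam l * (a l)%:R) *: mpolyX K a.
  rewrite /vf_apply scaler_suml; apply: eq_bigr => l _; rewrite ffunE mderivX.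
  rewrite -scalerAl -scalerAr scalerA -mpolyXD; have [->|al] := eqVneq (a l) 0%N.
    by rewrite mulr0 !scale0r.
  by congr (_ *: mpolyX K _); rewrite addmC submK // lep1mP.
move: p; apply: mpolyind => [|c a p _ _ IH]; first by rewrite vf_apply0 !mcoeff0 mulr0.
rewrite vf_applyD vf_applyZ aux !mcoeffD IH !mcoeffZ mcoeffX mulrDr.
by case: eqP => [->|_]; rewrite ?mulr0 ?mulr1 1?mulrC.
Qed.

Lemma mcoeff_bracket_diag lam v j m :
  mcoeff m (vf_bracket (diag_field lam) v j) = weight lam m j * mcoeff m (v j).
Proof.
rewrite ffunE mcoeffB mcoeff_diag_apply ffunE vf_applyZ vf_apply_mX mcoeffZ.
by rewrite /weight mulrBl.
Qed.

(** Let $A$ be the bracket with the diagonal field: $\prod_c (A - c)$, over the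
    other weights $c$ occurring in [v], kills all monomial fields of [v] but
    the required one, which it multiplies by a nonzero scalar. *)
Lemma weight_extraction (L : set (vecfield K n)) lam v i b :
  lie_subalgebra L -> L (diag_field lam) -> L v -> mcoeff b (v i) != 0 ->
  (forall j m, mcoeff m (v j) != 0 -> weight lam m j = weight lam b i -> j = i /\ m = b) ->
  L (coord_field i (mpolyX K b)).
Proof.
move=> [_ LD LZ Lbr] LDl Lv vb sep.
pose ws := [seq c <- flatten [seq [seq weight lam m j | m <- msupp (v j)] | j <- enum 'I_n] |
   c != weight lam b i].
pose u := foldr (fun c u => vf_bracket (diag_field lam) u - c *: u) v ws.
have Lu : L u.
  rewrite /u; elim: (ws) => //= w s IH; apply: LD; first exact: Lbr.
  by rewrite -scaleN1r; exact/LZ/LZ.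
have uE j m : mcoeff m (u j) = \prod_(c <- ws) (weight lam m j - c) * mcoeff m (v j).
  rewrite /u; elim: (ws) => [|w s IH]; first by rewrite big_nil mul1r.
  rewrite /= big_cons ffunE mcoeffD mcoeff_bracket_diag.
  by rewrite ffunE mcoeffN ffunE mcoeffZ -mulrBl IH mulrA.
pose c := mcoeff b (u i).
have c0 : c != 0.
  rewrite /c uE mulf_neq0 // prodf_seq_neq0.
  by apply/allP => w; rewrite mem_filter => /andP[wb _]; rewrite implyTb subr_eq0 eq_sym.
have ub : u = c *: coord_field i (mpolyX K b).
  apply/ffunP => j; apply/mpolyP => m; rewrite !ffunE.
  have [vm0|vm0] := eqVneq (mcoeff m (v j)) 0.
    rewrite uE vm0 mulr0; case: eqP => [ji|_]; last by rewrite scaler0 mcoeff0.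
    rewrite mcoeffZ mcoeffX; case: eqP => [bm|_]; last by rewrite mulr0.
    by move: vb; rewrite bm -ji vm0 eqxx.
  have [/(sep _ _ vm0)[-> ->]|wne] := eqVneq (weight lam m j) (weight lam b i).
    by rewrite eqxx mcoeffZ mcoeffX eqxx mulr1.
  have -> : mcoeff m (u j) = 0.
    rewrite uE; suff -> : \prod_(c <- ws) (weight lam m j - c) = 0 by rewrite mul0r.
    have win : weight lam m j \in ws.
      rewrite mem_filter wne; apply/flattenP; exists [seq weight lam m0 j | m0 <- msupp (v j)].
        by apply: map_f; rewrite mem_enum.
      by apply: map_f; rewrite mcoeff_msupp.
    by rewrite (big_rem _ win) /= subrr mul0r.
  case: eqP => [ji|_]; last by rewrite scaler0 mcoeff0.
  rewrite mcoeffZ mcoeffX; case: eqP => [bm|_]; last by rewrite mulr0.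
  by move: wne; rewrite bm ji eqxx.
by move: Lu => /(LZ c^-1); rewrite ub scalerA mulVf // scale1r.
Qed.

(** Equality of two weights is a linear condition on [lam], nontrivial when the
    exponent vectors $m - e_j$ and $b - e_i$ differ; some [lam] avoids the
    finitely many nontrivial ones.  If they agree and $b_i = 0$, the entry at
    $i$ is $-1$, which forces $j = i$. *)
Lemma separating_weights (S : seq ('I_n * multinom n)) : exists lam,
  forall j m i b, (j, m) \in S -> (i, b) \in S -> b i = 0%N ->
  weight lam m j = weight lam b i -> j = i /\ m = b.
Proof.
(* The difference of the two exponent vectors, with the negative entries moved
   across to stay in the naturals. *)
pose z (x y : 'I_n * multinom n) l : K :=
  (x.2 l + (l == y.1))%:R - (y.2 l + (l == x.1))%:R.
pose form x y : mpoly n K := \sum_l z x y l *: mX l.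
pose p := \prod_(xy <- [seq (x, y) | x <- S, y <- S] | form xy.1 xy.2 != 0) form xy.1 xy.2.
have /mpoly_nonroot[lam lamp] : p != 0.
  by rewrite /p prodf_seq_neq0; apply/allP => xy _; apply/implyP.
exists lam => j m i b jmS ibS bi wE.
pose x := (j, m); pose y := (i, b).
have form0 : form x y = 0.
  apply/eqP/negPn/negP => f0; move: lamp; rewrite /p rmorph_prod prodf_seq_neq0.
  move=> /allP/(_ (x, y)); rewrite f0 /= => /(_ _)/negP; apply.
    by apply/allpairsP; exists (x, y).
  rewrite /form raddf_sum; apply/eqP; transitivity (weight lam m j - weight lam b i).
    have deltaE k : \sum_l (l == k)%:R * lam l = lam k.
      by rewrite (bigD1 k) //= eqxx mul1r big1 ?addr0 // => l /negPf ->; rewrite mul0r.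
    transitivity (\sum_l lam l * (m l)%:R - \sum_l lam l * (b l)%:R
        + (\sum_l (l == i)%:R * lam l - \sum_l (l == j)%:R * lam l)); last first.
      by rewrite !deltaE /weight; ring.
    rewrite -!sumrB -big_split; apply: eq_bigr => l _ /=.
    by rewrite mevalZ mevalXU /z /= !natrD; ring.
  by rewrite wE subrr.
have zE l : (m l + (l == i) = b l + (l == j))%N.
  have := congr1 (mcoeff (mnm1 l)) form0; rewrite /form raddf_sum mcoeff0 (bigD1 l) //= big1.
    by rewrite mcoeffZ mcoeffXU eqxx mulr1 addr0 => /eqP; rewrite /z subr_eq0 eq_natr => /eqP.
  by move=> k /negPf kl; rewrite mcoeffZ mcoeffXU kl mulr0.
have ji : j = i.
  by apply/eqP; move: (zE i); rewrite bi eqxx eq_sym; case: eqP => // _; lia.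
split=> //; apply/mnmP => l; move: (zE l); rewrite ji; exact: addIn.
Qed.

Lemma diagonal_generation (d : vecfield K n) : (2 <= n)%N ->
  (forall i j r, i != j -> (r <= 2)%N -> mcoeff (mnm_muln (mnm1 j) r) (d i) != 0) ->
  nonconstant_div d ->
  exists lam, forall L, lie_subalgebra L -> L d -> L (diag_field lam) -> forall v, L v.
Proof.
move=> n2 dne dnc.
pose S := flatten [seq [seq (j, m) | m <- msupp (d j)] | j <- enum 'I_n].
have inS j m : mcoeff m (d j) != 0 -> (j, m) \in S.
  move=> h; apply/flattenP; exists [seq (j, m0) | m0 <- msupp (d j)].
    by apply: map_f; rewrite mem_enum.
  by apply: map_f; rewrite mcoeff_msupp.
have [lam sep] := separating_weights S.
exists lam => L subL Ld LD; apply: (@generation_from_shears L subL n2 _ d) => // i j r ij r2.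
rewrite mpolyXn; apply: weight_extraction subL LD Ld _ _; first exact: dne.
move=> k m km; apply: sep; [exact: inS|apply/inS/dne => //|].
by rewrite mulmnE mnm1E eq_sym (negPf ij).
Qed.

(** * Conjugation by polynomial automorphisms *)

Definition psubst h : mpoly n K -> mpoly n K := mmap (@mpolyC n K) h.

HB.instance Definition _ h := GRing.RMorphism.copy (psubst h) (mmap (@mpolyC n K) h).

Lemma psubstC h c : psubst h (mpolyC n c) = mpolyC n c.
Proof. exact: mmapC. Qed.

Lemma psubst_mX h i : psubst h (mX i) = h i.
Proof. by rewrite /psubst mmapX mmap1U. Qed.

Lemma psubstD h : {morph psubst h : p q / p + q}.
Proof. exact: rmorphD. Qed.

Lemma psubstB h : {morph psubst h : p q / p - q}.
Proof. exact: rmorphB. Qed.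

Lemma psubstM h : {morph psubst h : p q / p * q}.
Proof. exact: rmorphM. Qed.

Lemma psubst0 h : psubst h 0 = 0.
Proof. exact: rmorph0. Qed.

Lemma psubst_sum h I (r : seq I) (P : pred I) (F : I -> mpoly n K) :
  psubst h (\sum_(x <- r | P x) F x) = \sum_(x <- r | P x) psubst h (F x).
Proof. exact: raddf_sum. Qed.

Lemma psubstZ h c p : psubst h (c *: p) = c *: psubst h p.
Proof. by rewrite -!mul_mpolyC psubstM psubstC. Qed.

Lemma meval_psubst h x p : meval x (psubst h p) = meval (fun k => meval x (h k)) p.
Proof.
move: p; apply: mpoly_alg_ind => [c|k|p q hp hq|p q hp hq].
- by rewrite psubstC !mevalC.
- by rewrite psubst_mX mevalXU.
- by rewrite psubstD !mevalD hp hq.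
- by rewrite psubstM !mevalM hp hq.
Qed.

Lemma mderiv_psubst h j p :
  mderiv j (psubst h p) = \sum_k psubst h (mderiv k p) * mderiv j (h k).
Proof.
rewrite (chain_rule (phi := psubst h) (D := mderiv j)) /=.
- by apply: eq_bigr => k _; rewrite psubst_mX.
- exact: mderivD.
- exact: mderivM.
- by move=> c; rewrite psubstC mderivC.
Qed.

Lemma psubst_id h p : (forall k, h k = mX k) -> psubst h p = p.
Proof.
move=> hE; move: p; apply: mpoly_alg_ind => [c|k|p q hp hq|p q hp hq].
- by rewrite psubstC.
- by rewrite psubst_mX.
- by rewrite psubstD hp hq.
- by rewrite psubstM hp hq.
Qed.

(** The two substitutions compose to the identity in one order only; an
    automorphism is given by a pair that is inverse in both orders. *)
Definition inverse_subst h g : Prop := forall i, psubst g (h i) = mX i.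

Lemma psubstK h g p : inverse_subst h g -> psubst g (psubst h p) = p.
Proof.
move=> hg; move: p; apply: mpoly_alg_ind => [c|k|p q hp hq|p q hp hq].
- by rewrite !psubstC.
- by rewrite psubst_mX.
- by rewrite !psubstD hp hq.
- by rewrite !psubstM hp hq.
Qed.

(** A derivation is determined by its values on the coordinates. *)
Lemma vf_apply_unique d (D : mpoly n K -> mpoly n K) :
  {morph D : x y / x + y} -> (forall x y, D (x * y) = D x * y + x * D y) ->
  (forall c, D (mpolyC n c) = 0) -> (forall i, D (mX i) = d i) -> D =1 vf_apply d.
Proof.
move=> DD DM DC DX p; rewrite (chain_rule (phi := idfun) DD DM DC).
by apply: eq_bigr => i _; rewrite DX mulrC.
Qed.

Lemma vf_apply_bracket d e p :
  vf_apply (vf_bracket d e) p = vf_apply d (vf_apply e p) - vf_apply e (vf_apply d p).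
Proof.
apply/esym; move: p.
apply: (@vf_apply_unique _ (fun p => vf_apply d (vf_apply e p) - vf_apply e (vf_apply d p))).
- by move=> x y; rewrite !vf_applyD; ring.
- by move=> x y; rewrite !vf_applyM !vf_applyD !vf_applyM; ring.
- by move=> c; rewrite !vf_applyC subrr.
- by move=> i; rewrite !vf_apply_mX ffunE.
Qed.

(** If $H$ and $G$ are the algebra morphisms given by [h] and [g], inverse to
    each other, this is the derivation $G \circ d \circ H$
    (lemma [vf_apply_conj]), read off on the coordinates. *)
Definition vf_conj h g d : vecfield K n := [ffun j => psubst g (vf_apply d (h j))].

Lemma vf_applyDl d e p : vf_apply (d + e) p = vf_apply d p + vf_apply e p.
Proof. by rewrite /vf_apply -big_split; apply: eq_bigr => i _; rewrite ffunE mulrDl. Qed.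

Lemma vf_applyZl c d p : vf_apply (c *: d) p = c *: vf_apply d p.
Proof. by rewrite /vf_apply scaler_sumr; apply: eq_bigr => i _; rewrite ffunE scalerAl. Qed.

Lemma vf_conjD h g d e : vf_conj h g (d + e) = vf_conj h g d + vf_conj h g e.
Proof. by apply/ffunP => j; rewrite !ffunE vf_applyDl psubstD. Qed.

Lemma vf_conjZ h g c d : vf_conj h g (c *: d) = c *: vf_conj h g d.
Proof. by apply/ffunP => j; rewrite !ffunE vf_applyZl psubstZ. Qed.

Lemma vf_apply_conj h g d p : inverse_subst h g ->
  vf_apply (vf_conj h g d) p = psubst g (vf_apply d (psubst h p)).
Proof.
move=> hg; apply/esym; move: p.
apply: (@vf_apply_unique _ (fun p => psubst g (vf_apply d (psubst h p)))).
- by move=> x y; rewrite psubstD vf_applyD psubstD.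
- by move=> x y; rewrite psubstM vf_applyM psubstD !psubstM !(psubstK _ hg).
- by move=> c; rewrite psubstC vf_applyC psubst0.
- by move=> i; rewrite psubst_mX ffunE.
Qed.

Lemma vf_conj_bracket h g d e : inverse_subst h g -> inverse_subst g h ->
  vf_conj h g (vf_bracket d e) = vf_bracket (vf_conj h g d) (vf_conj h g e).
Proof.
move=> hg gh; apply/ffunP => j; rewrite [LHS]ffunE [RHS]ffunE vf_apply_bracket psubstB.
have apply_conj u v : vf_apply (vf_conj h g u) (vf_conj h g v j) = psubst g (vf_apply u (vf_apply v (h j))).
  by rewrite (vf_apply_conj _ _ hg) [vf_conj h g v j]ffunE (psubstK _ gh).
by rewrite !apply_conj.
Qed.

Lemma vf_conjK h g d : inverse_subst h g -> inverse_subst g h ->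
  vf_conj g h (vf_conj h g d) = d.
Proof.
move=> hg gh; apply/ffunP => j; rewrite ffunE vf_apply_conj // (psubstK _ gh).
by rewrite gh vf_apply_mX.
Qed.

Definition generating_pair d e : Prop :=
  forall L, lie_subalgebra L -> L d -> L e -> forall v, L v.

(** Conjugation is an automorphism of the Lie algebra, so the preimage of a
    subalgebra under it is a subalgebra. *)
Lemma generating_pair_conj h g d e : inverse_subst h g -> inverse_subst g h ->
  generating_pair (vf_conj h g d) e -> generating_pair d (vf_conj g h e).
Proof.
move=> hg gh gen L [L0 LD LZ Lbr] Ld Le v.
rewrite -(vf_conjK v hg gh).
apply: (gen (fun w => L (vf_conj g h w))) => //; last by rewrite vf_conjK.
split=> [|x y Lx Ly|c x Lx|x y Lx Ly].
- by have := LZ 0 _ Le; rewrite -vf_conjZ !scale0r.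
- by rewrite vf_conjD; apply: LD.
- by rewrite vf_conjZ; apply: LZ.
- by rewrite vf_conj_bracket //; apply: Lbr.
Qed.

(** * Shears and translations *)

Definition shear i q : 'I_n -> mpoly n K := fun k => if k == i then mX k + q else mX k.

Lemma psubst_shear i q f : mderiv i f = 0 -> psubst (shear i q) f = f.
Proof.
move=> fi; rewrite /psubst /mmap [RHS]mpolyE big_seq [RHS]big_seq.
apply: eq_bigr => m /(mderiv_msupp0 fi) mi; rewrite mul_mpolyC; congr (_ *: _).
rewrite mpolyXE_id; apply: eq_bigr => k _; rewrite /shear.
by case: eqP => [->|//]; rewrite mi !expr0.
Qed.

(** The condition on [q] says that [q] itself is fixed by the substitution. *)
Lemma inverse_shear i q : mderiv i q = 0 -> inverse_subst (shear i q) (shear i (- q)).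
Proof.
move=> qi k; rewrite [shear i q k]/shear; case: eqP => [->|/eqP ki].
  by rewrite psubstD psubst_mX psubst_shear // /shear eqxx subrK.
by rewrite psubst_mX /shear (negPf ki).
Qed.

Definition shear_conj i q d := vf_conj (shear i q) (shear i (- q)) d.

Lemma shear_conjE i q d j : shear_conj i q d j =
  psubst (shear i (- q)) (d j) + (j == i)%:R * psubst (shear i (- q)) (vf_apply d q).
Proof.
rewrite ffunE [shear i q j]/shear; case: eqP => _; last by rewrite vf_apply_mX mul0r addr0.
by rewrite vf_applyD psubstD vf_apply_mX mul1r.
Qed.

(** The Jacobian matrix of a shear is unipotent: the terms created in
    $\partial_j$ of the $j$-th components cancel against the divergence of the
    new summand $d(q)$ in the $i$-th component. *)
Lemma div_shear_conj i q d : mderiv i q = 0 ->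
  vf_div (shear_conj i q d) = psubst (shear i (- q)) (vf_div d).
Proof.
move=> qi; set G := psubst (shear i (- q)).
have dG j p : mderiv j (G p) = G (mderiv j p) - G (mderiv i p) * mderiv j q.
  rewrite /G mderiv_psubst -/G.
  transitivity (\sum_k G (mderiv k p) * ((k == j)%:R - (k == i)%:R * mderiv j q)).
    apply: eq_bigr => k _; rewrite /shear; case: eqP => _.
      by rewrite mderivD mderivN mderiv_mX mul1r.
    by rewrite mderiv_mX mul0r subr0.
  have pick l (F : 'I_n -> mpoly n K) : \sum_k F k * (k == l)%:R = F l.
    rewrite (bigD1 l) //= eqxx mulr1 big1 ?addr0 // => k /negPf ->; exact: mulr0.
  under eq_bigr do rewrite mulrBr mulrA.
  by rewrite sumrB -mulr_suml !pick.
have Gdq j : G (mderiv j q) = mderiv j q.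
  by apply: psubst_shear => //; rewrite mderiv_comm qi mderiv0.
have -> : vf_div (shear_conj i q d) = \sum_j mderiv j (G (d j)) + mderiv i (G (vf_apply d q)).
  rewrite /vf_div (bigD1 i) //= [in RHS](bigD1 i) //= shear_conjE eqxx mul1r mderivD -/G.
  rewrite addrAC; congr (_ + _); congr (_ + _); apply: eq_bigr => j /negPf ji.
  by rewrite shear_conjE ji mul0r addr0.
rewrite (eq_bigr (fun j => G (mderiv j (d j)) - G (mderiv i (d j)) * mderiv j q)); last first.
  by move=> j _; exact: dG.
have cancel : mderiv i (G (vf_apply d q)) = \sum_j G (mderiv i (d j)) * mderiv j q.
  rewrite dG qi mulr0 subr0 /vf_apply raddf_sum /G psubst_sum -/G; apply: eq_bigr => j _.
  by rewrite /= mderivM mderiv_comm qi mderiv0 mulr0 addr0 /G psubstM -/G Gdq.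
by rewrite cancel sumrB subrK /vf_div /G psubst_sum.
Qed.

(** The substitution $x_i \mapsto x_i - c q$ is polynomial in $c$: [Gam] is the
    same substitution with a formal parameter in place of $c$, and its first
    two Taylor coefficients are the identity and $-q \partial_i$. *)
Lemma shear_subst_family i q : exists Gam : mpoly n K -> {poly mpoly n K},
  [/\ forall p c, (Gam p).[mpolyC n c] = psubst (shear i (- (c *: q))) p,
      forall p, (Gam p)`_0 = p & forall p, (Gam p)`_1 = - (q * mderiv i p)].
Proof.
pose X k : {poly mpoly n K} := (mX k)%:P - (k == i)%:R *: (q *: 'X).
pose Gam := mmap (polyC \o @mpolyC n K) X.
have GC c : Gam (mpolyC n c) = (mpolyC n c)%:P by rewrite /Gam mmapC.
have GX k : Gam (mX k) = X k by rewrite /Gam mmapX mmap1U.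
have GD : {morph Gam : p r / p + r} by exact: rmorphD.
have GM : {morph Gam : p r / p * r} by exact: rmorphM.
have dC c : deriv (Gam (mpolyC n c)) = 0 by rewrite GC derivC.
have dG p : deriv (Gam p) = \sum_k Gam (mderiv k p) * deriv (Gam (mX k)).
  exact: (chain_rule (@derivD _) (@derivM _) dC).
clearbody Gam.
have GE p c : (Gam p).[mpolyC n c] = psubst (shear i (- (c *: q))) p.
  move: p; apply: mpoly_alg_ind => [b|k|p r hp hr|p r hp hr].
  - by rewrite GC psubstC hornerC.
  - rewrite GX /X psubst_mX /shear; case: eqP => _.
      by rewrite scale1r !hornerE mulrC mul_mpolyC.
    by rewrite scale0r subr0 hornerC.
  - by rewrite psubstD -hp -hr GD hornerD.
  - by rewrite psubstM -hp -hr GM hornerM.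
have G0 p : (Gam p)`_0 = p.
  rewrite -horner_coef0 -(mpolyC0 n K) GE scale0r oppr0.
  by apply: psubst_id => k; rewrite /shear addr0 if_same.
exists Gam; split=> // p.
have := coef_deriv (Gam p) 0; rewrite mulr1n => <-.
rewrite dG (bigD1 i) //= big1 => [|k /negPf ki]; last first.
  by rewrite GX /X ki scale0r subr0 derivC mulr0.
rewrite addr0 GX /X eqxx scale1r derivB derivC derivZ derivX sub0r.
by rewrite mulrN -scalerAr mulr1 coefN coefZ G0.
Qed.

(** The components of a sheared field are polynomial in the parameter $c$; the
    linear coefficient of the $i$-th one comes from the bracket of $- q \partial_i$
    with the field. *)
Lemma shear_family i q d j : exists P : {poly mpoly n K},
  [/\ forall c, P.[mpolyC n c] = shear_conj i (c *: q) d j,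
      P`_0 = d j & j = i -> P`_1 = vf_apply d q - q * mderiv i (d i)].
Proof.
have [Gam [GE G0 G1]] := shear_subst_family i q.
exists (Gam (d j) + (j == i)%:R *: (Gam (vf_apply d q) * 'X)); split=> [c||->].
- rewrite shear_conjE hornerD hornerZ hornerM hornerX !GE vf_applyZ psubstZ.
  by congr (_ + _ * _); rewrite mulrC mul_mpolyC.
- by rewrite coefD coefZ coefMX G0 mulr0 addr0.
- by rewrite eqxx scale1r coefD coefMX G0 G1 addrC.
Qed.

(** Some coefficient of the second derivative of the family is a nonzero
    polynomial in the parameter. *)
Lemma curved_family (P : {poly mpoly n K}) k r : mderiv k (mderiv k P`_r) != 0 ->
  exists2 s : {poly K}, s != 0 & forall c, s.[c] != 0 -> mderiv k (mderiv k P.[mpolyC n c]) != 0.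
Proof.
move=> Pr; have [m mP] : exists m, mcoeff m (mderiv k (mderiv k P`_r)) != 0.
  apply: contrapT => h; move/eqP: Pr; apply; apply/mpolyP => m; rewrite mcoeff0.
  by apply/eqP; apply: contrapT => /negP hm; apply: h; exists m.
pose c r := mcoeff m (mderiv k (mderiv k P`_r)).
have c0 x : (size P <= x)%N -> c x = 0.
  by move=> h; rewrite /c nth_default // !mderiv0 mcoeff0.
exists (\poly_(x < size P) c x).
  apply: contraNneq mP => /(congr1 (fun s : {poly K} => s`_r)); rewrite coef_poly coef0 -/(c r).
  by case: ltnP => [_ ->//|/c0 ->].
move=> t; apply: contraNneq => h; apply/eqP.
transitivity (mcoeff m (mderiv k (mderiv k P.[mpolyC n t]))); last by rewrite h mcoeff0.
pose T p := mcoeff m (mderiv k (mderiv k p)).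
have TD : {morph T : p q / p + q} by move=> p q; rewrite /T !mderivD mcoeffD.
have T0 : T 0 = 0 by rewrite /T !mderiv0 mcoeff0.
rewrite -/(T _) horner_poly horner_coef (big_morph T TD T0); apply: eq_bigr => x _ /=.
by rewrite -rmorphXn /= [P`_x * _]mulrC /T mul_mpolyC !mderivZ mcoeffZ mulrC.
Qed.

Lemma common_nonroot (T : eqType) (s : seq T) (Q : T -> K -> Prop) :
  (forall x, x \in s -> exists2 r : {poly K}, r != 0 & forall c, r.[c] != 0 -> Q x c) ->
  exists c, forall x, x \in s -> Q x c.
Proof.
move=> h; suff [r r0 rQ] : exists2 r : {poly K}, r != 0 &
    forall c, r.[c] != 0 -> forall x, x \in s -> Q x c.
  by have [c /rQ] := poly_nonroot r0; exists c.
elim: s h => [_|x s IH h]; first by exists 1; rewrite ?oner_neq0.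
have [|r r0 rQ] := IH; first by move=> y ys; apply: h; rewrite inE ys orbT.
have [r' r'0 r'Q] := h x (mem_head _ _).
exists (r' * r); first by rewrite mulf_neq0.
move=> c; rewrite hornerM mulf_eq0 negb_or => /andP[c1 c2] y.
by rewrite inE => /orP[/eqP ->|]; [exact: r'Q|exact: rQ].
Qed.

(** This single condition on $(i, k)$ also forces $d_i$ and $\partial_k d_i$ to
    be nonzero, so it provides all the coefficients that are needed. *)
Definition curved d i k := mderiv k (mderiv k (d i)) != 0.

Lemma vf_apply_Xn d k r : vf_apply d (mX k ^+ r.+1) = r.+1%:R * mX k ^+ r * d k.
Proof.
elim: r => [|r IH]; first by rewrite expr1 expr0 vf_apply_mX !mul1r.
rewrite exprS vf_applyM IH vf_apply_mX -[in RHS]addn1 natrD mulrDl mulrDl addrC.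
congr (_ + _); last by rewrite mul1r mulrC.
by rewrite !mulrA exprS !mulrA; congr (_ * _ * _); exact: mulrC.
Qed.

Lemma mderiv2_X2 k f : f != 0 -> mderiv k (mderiv k (mX k ^+ 2 * f)) != 0.
Proof.
move=> f0; have [m mf] : exists m, mcoeff m f != 0.
  by exists (mlead f); rewrite mleadc_eq0.
apply: contraNneq mf => /(congr1 (mcoeff m)); rewrite mcoeff0 !mcoeff_mderiv.
have -> : mnm_add (mnm_add m (mnm1 k)) (mnm1 k) = mnm_add (mnm_muln (mnm1 k) 2) m.
  by rewrite mulmS mulm1n -addmA addmC.
rewrite mpolyXn mulrC mcoeffMX -mulrnA => /eqP; rewrite -mulr_natr mulf_eq0 natr_eq0.
by rewrite muln_eq0 /= orbF.
Qed.

(** The first-order term of the shear along $x_k^{r+1}$ is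
    $x_k^r ((r+1) d_k - x_k \partial_i d_i)$.  Since $d_k \ne 0$ the second
    factor cannot vanish both for $r = 2$ and for $r = 3$, and multiples of
    $x_k^2$ are not killed by $\partial_k^2$.  A generic value of the parameter
    then preserves the conditions in [s]. *)
Lemma curve_by_shear d (s : seq ('I_n * 'I_n)) i k : i != k -> d k != 0 ->
  (forall x, x \in s -> curved d x.1 x.2) ->
  exists q, mderiv i q = 0 /\
    forall x, x \in (i, k) :: s -> curved (shear_conj i q d) x.1 x.2.
Proof.
move=> ik dk ds.
have qi r c : mderiv i (c *: mX k ^+ r) = 0 by rewrite mderivZ mderiv_mXn // scaler0.
have [r Tr] : exists r, mderiv k (mderiv k
    (vf_apply d (mX k ^+ r) - mX k ^+ r * mderiv i (d i))) != 0.
  have [e|ne] := eqVneq (3%:R * d k) (mX k * mderiv i (d i)).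
    exists 4; rewrite vf_apply_Xn.
    set D := mderiv i (d i) in e *.
    have -> : 4%:R * mX k ^+ 3 * d k - mX k ^+ 4 * D = mX k ^+ 2 * (mX k * d k).
      have -> : mX k ^+ 4 * D = mX k ^+ 3 * (mX k * D) by ring.
      by rewrite -e; ring.
    by apply: mderiv2_X2; rewrite mulf_neq0 // -msize_poly_eq0 msizeX.
  exists 3; rewrite vf_apply_Xn.
  have -> : 3%:R * mX k ^+ 2 * d k - mX k ^+ 3 * mderiv i (d i) =
      mX k ^+ 2 * (3%:R * d k - mX k * mderiv i (d i)) by ring.
  by apply: mderiv2_X2; rewrite subr_eq0.
pose q := mX k ^+ r.
have [c cP] : exists c, forall x, x \in (i, k) :: s -> curved (shear_conj i (c *: q) d) x.1 x.2.
  apply: common_nonroot => x; rewrite inE => xs.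
  have [P [PE P0 P1]] := shear_family i q d x.1.
  have [t Pt] : exists t, mderiv x.2 (mderiv x.2 P`_t) != 0.
    case/orP: xs => [/eqP xik|/ds cx]; last by exists 0%N; rewrite P0.
    by exists 1%N; rewrite P1 xik.
  by have [y y0 yP] := curved_family Pt; exists y => // c /yP; rewrite PE.
by exists (c *: q); split; first exact: qi.
Qed.

Definition translation (x : 'I_n -> K) : 'I_n -> mpoly n K := fun k => mX k + mpolyC n (x k).

Lemma inverse_translation (x : 'I_n -> K) :
  inverse_subst (translation x) (translation (fun k => - x k)).
Proof.
move=> k; rewrite {2}/translation psubstD psubst_mX psubstC /translation.
by rewrite mpolyCN subrK.
Qed.

Definition translation_conj x d := vf_conj (translation (fun k => - x k)) (translation x) d.

Lemma translation_conjE x d j : translation_conj x d j = psubst (translation x) (d j).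
Proof. by rewrite ffunE vf_applyD vf_apply_mX vf_applyC addr0. Qed.

Lemma mderiv_translation x k p :
  mderiv k (psubst (translation x) p) = psubst (translation x) (mderiv k p).
Proof.
rewrite mderiv_psubst (bigD1 k) //= big1 => [|l /negPf lk].
  by rewrite mderivD mderiv_mX eqxx mderivC !addr0 mulr1.
by rewrite mderivD mderiv_mX lk mderivC addr0 mulr0.
Qed.

Lemma div_translation_conj x d :
  vf_div (translation_conj x d) = psubst (translation x) (vf_div d).
Proof.
rewrite /vf_div psubst_sum; apply: eq_bigr => j _.
by rewrite translation_conjE mderiv_translation.
Qed.

Lemma mcoeff0_translation x p : mcoeff mnm0 (psubst (translation x) p) = meval x p.
Proof.
move: p; apply: mpoly_alg_ind => [c|k|p q hp hq|p q hp hq].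
- by rewrite psubstC mevalC mpolyCK.
- by rewrite psubst_mX mevalXU mcoeffD mcoeffX mnm1_eq0 add0r mpolyCK.
- by rewrite psubstD mcoeffD hp hq mevalD.
- by rewrite psubstM rmorphM /= hp hq mevalM.
Qed.

(** * Reduction to generic Taylor coefficients at the origin *)

Section Reduction.
Variable P : vecfield K n -> Prop.
Hypothesis P_conj : forall h g d, inverse_subst h g -> inverse_subst g h ->
  P (vf_conj h g d) -> P d.

Lemma nonconstant_psubst h g d d' : inverse_subst g h ->
  vf_div d' = psubst g (vf_div d) -> nonconstant_div d -> nonconstant_div d'.
Proof.
move=> gh e nc [c d'c]; apply: nc; exists c.
by rewrite -(psubstK (vf_div d) gh) -e d'c psubstC.
Qed.

(** If $d_k = 0$, a preliminary shear along a coordinate $x_{k_0}$ with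
    $d_{k_0} \ne 0$ makes the $k$-th component nonzero. *)
Lemma reduce_by_curving d (s : seq ('I_n * 'I_n)) i k : i != k -> d != 0 -> nonconstant_div d ->
  (forall x, x \in s -> curved d x.1 x.2) ->
  (forall d', nonconstant_div d' -> (forall x, x \in (i, k) :: s -> curved d' x.1 x.2) -> P d') ->
  P d.
Proof.
have step e s' i' k' : i' != k' -> e k' != 0 -> nonconstant_div e ->
    (forall x, x \in s' -> curved e x.1 x.2) ->
    (forall d', nonconstant_div d' -> (forall x, x \in (i', k') :: s' -> curved d' x.1 x.2) ->
      P d') -> P e.
  move=> ik ek enc es hP; have [q [qi qs]] := curve_by_shear ik ek es.
  have inv1 := inverse_shear qi.
  have inv2 : inverse_subst (shear i' (- q)) (shear i' q).
    by rewrite -{2}[q]opprK; apply: inverse_shear; rewrite mderivN qi oppr0.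
  apply: (P_conj inv1 inv2); apply: hP => //.
  exact: nonconstant_psubst inv2 (div_shear_conj _ qi) enc.
move=> ik d0 dnc ds hP.
have [dk|dk] := eqVneq (d k) 0; last exact: step ik dk dnc ds hP.
have [k0 dk0] : exists k0, d k0 != 0.
  apply/existsP; apply: contraNT d0 => /existsPn h; apply/eqP/ffunP => l.
  by rewrite ffunE; apply/eqP; rewrite -[_ == _]negbK h.
have kk0 : k != k0 by apply: contraNneq dk0 => <-; rewrite dk.
apply: (step d s k k0) => // d1 d1nc d1s.
apply: (step d1 s i k) => //.
  by apply: contraNneq (d1s _ (mem_head _ _)) => /= ->; rewrite !mderiv0.
by move=> x xs; apply: d1s; rewrite inE xs orbT.
Qed.

(** Once all pairs are curved, the product of the components and of their first
    and second derivatives is a nonzero polynomial; translating a point where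
    it does not vanish to the origin gives the Taylor coefficients. *)
Lemma reduce_to_generic :
  (forall d, (forall i j r, i != j -> (r <= 2)%N -> mcoeff (mnm_muln (mnm1 j) r) (d i) != 0) ->
    nonconstant_div d -> P d) ->
  forall d, d != 0 -> nonconstant_div d -> P d.
Proof.
move=> base d d0 dnc.
pose pairs : seq ('I_n * 'I_n) := [seq x <- enum {: 'I_n * 'I_n} | x.1 != x.2].
have curved_base e : nonconstant_div e -> (forall x, x \in pairs -> curved e x.1 x.2) -> P e.
  move=> enc ec.
  pose f (x : 'I_n * 'I_n) := e x.1 * mderiv x.2 (e x.1) * mderiv x.2 (mderiv x.2 (e x.1)).
  have /mpoly_nonroot[x] : \prod_(y <- pairs) f y != 0.
    rewrite prodf_seq_neq0; apply/allP => y /ec cy /=; rewrite !mulf_neq0 //.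
      by apply: contraNneq cy => ->; rewrite !mderiv0.
    by apply: contraNneq cy => ->; rewrite !mderiv0.
  rewrite rmorph_prod prodf_seq_neq0 => /allP xf.
  apply: (P_conj (h := translation (fun k => - x k)) (g := translation x)).
  - have := inverse_translation (fun k => - x k).
    by have -> : translation (fun k => - - x k) = translation x by
      apply: funext => k; rewrite /translation opprK.
  - exact: inverse_translation.
  rewrite -/(translation_conj x e); apply: base; last first.
    apply: nonconstant_psubst (div_translation_conj x e) enc.
    exact: (inverse_translation x).
  move=> i j r ij r2.
  have := xf (i, j); rewrite mem_filter mem_enum /= ij => /(_ isT).
  rewrite /f /= !mevalM !mulf_eq0 !negb_or => /andP[/andP[]].
  rewrite -!mcoeff0_translation -!mderiv_translation -translation_conjE.
  set p := translation_conj x e i.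
  case: r r2 => [|[|[|//]]] _ h0 h1 h2.
  - by rewrite mulm0n.
  - by move: h1; rewrite mulm1n mcoeff_mderiv add0m mnm0E.
  - move: h2; rewrite !mcoeff_mderiv add0m; apply: contraNneq.
    by rewrite mulmS mulm1n => ->; rewrite !mul0rn.
(* Treat the pairs one at a time: [s] lists those that are already curved. *)
have [ps pairsE] : exists ps, ps = pairs by exists pairs.
have ps_neq x : x \in ps -> x.1 != x.2 by rewrite pairsE mem_filter => /andP[].
have {}curved_base e : nonconstant_div e ->
    (forall x, x \in [::] ++ ps -> curved e x.1 x.2) -> P e by rewrite pairsE; apply: curved_base.
have dc : forall x : 'I_n * 'I_n, x \in [::] -> curved d x.1 x.2 by [].
clear pairs pairsE.
move: ([::] : seq ('I_n * 'I_n)) ps ps_neq curved_base d d0 dnc dc => s ps.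
elim: ps s => [|[i k] ps IH] s ps_neq hP d d0 dnc dc.
  by apply: hP => // x; rewrite cats0; apply: dc.
apply: (reduce_by_curving (s := s) (i := i) (k := k)) => //.
  exact: (ps_neq (i, k) (mem_head _ _)).
move=> d' d'nc d's; apply: (IH ((i, k) :: s)) => //.
- by move=> x xs; apply: ps_neq; rewrite inE xs orbT.
- move=> e enc es; apply: hP => // x; rewrite mem_cat => xs; apply: es.
  by move: xs; rewrite mem_cat !inE orbCA orbA.
- apply: contraTneq (d's _ (mem_head _ _)) => ->.
  by rewrite /curved ffunE !mderiv0 eqxx.
Qed.

End Reduction.

End Algebra.

(** * The complex exponential *)

Section LinearApproximation.
Variable F : numFieldType.
Implicit Types (f : F -> F) (x df : F).

(** Differentiability without division, which can be read in the same way over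
    the reals and over the complex numbers. *)
Definition linear_approx f x df := forall e : F, 0 < e -> exists2 d : F, 0 < d &
  forall h, `|h| < d -> `|f (x + h) - f x - h * df| <= e * `|h|.

Lemma is_derive_approx f x df :
  is_derive (x : F^o) (1 : F^o) (f : F^o -> F^o) df -> linear_approx f x df.
Proof.
move=> [dv dfE] e e0.
have : (fun h : F^o => h^-1 *: ((((f : F^o -> F^o) \o shift (x : F^o))
    (h *: (1 : F^o)) - f x) : F^o)) @ 0^' --> (df : F^o).
  by rewrite -dfE; exact: dv.
move/cvgrPdist_le => /(_ e e0); rewrite near_withinE => /nbhs_ballP[d /= d0 dP].
exists d => // h hd; have [->|h0] := eqVneq h 0.
  by rewrite addr0 subrr mul0r subrr normr0 mulr0.
have := dP h; rewrite -ball_normE /= sub0r normrN => /(_ hd h0).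
rewrite [h *: _]mulr1 => hP.
have -> : f (x + h) - f x - h * df = - h * (df - h^-1 * (f (h + x) - f x)).
  by rewrite [h + x]addrC; field.
by rewrite normrM normrN mulrC ler_pM2r ?normr_gt0.
Qed.

Lemma approx_is_derive f x df : linear_approx f x df ->
  is_derive (x : F^o) (1 : F^o) (f : F^o -> F^o) df.
Proof.
move=> fP.
have fcvg : (fun h : F^o => h^-1 *: ((((f : F^o -> F^o) \o shift (x : F^o))
    (h *: (1 : F^o)) - f x) : F^o)) @ 0^' --> (df : F^o).
  apply/cvgrPdist_le => e e0; have [d d0 dP] := fP e e0.
  rewrite near_withinE; apply/nbhs_ballP; exists d => // h.
  rewrite -ball_normE /= sub0r normrN => hd h0; rewrite [h *: _]mulr1.
  have := dP h hd.
  have -> : f (x + h) - f x - h * df = - h * (df - h^-1 * (f (h + x) - f x)).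
    by rewrite [h + x]addrC; field.
  by rewrite normrM normrN mulrC ler_pM2r ?normr_gt0.
split; first by apply/cvg_ex; exists df.
exact: (cvg_lim (@norm_hausdorff _ _) fcvg).
Qed.
End LinearApproximation.

Section ComplexExponential.
Variable R : realType.
Local Open Scope complex_scope.
Local Notation re := complex.Re.
Local Notation im := complex.Im.

Definition cexp (z : R[i]) : R[i] :=
  (expR (re z) * cos (im z)) +i* (expR (re z) * sin (im z)).

Lemma cexp0 : cexp 0 = 1.
Proof. by rewrite /cexp /= expR0 cos0 sin0 mul1r mulr0. Qed.

Lemma cexpD z w : cexp (z + w) = cexp z * cexp w.
Proof.
case: z w => [a b] [c d]; rewrite /cexp /= expRD cosD sinD.
by apply/eqP; rewrite eq_complex /=; apply/andP; split; apply/eqP; ring.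
Qed.

Lemma real_linear_approx0 (f : R -> R) df : is_derive (0 : R) 1 f df ->
  forall e, 0 < e -> exists2 d, 0 < d & forall h, `|h| < d -> `|f h - f 0 - h * df| <= e * `|h|.
Proof.
move=> fd e e0; have [d d0 dP] := @is_derive_approx R f 0 df fd e e0.
by exists d => // h hd; have := dP h hd; rewrite add0r.
Qed.

Lemma normc_le_sum (x y : R) : `|x +i* y| <= (`|x| + `|y|)%:C.
Proof.
rewrite normc_def lecR /= -[leRHS]ger0_norm ?addr_ge0 // -sqrtr_sqr ler_sqrt ?sqr_ge0 //.
have := mulr_ge0 (normr_ge0 x) (normr_ge0 y).
by rewrite -(real_normK (num_real x)) -(real_normK (num_real y)); nra.
Qed.

Lemma im_le_normc (z : R[i]) : `|im z|%:C <= `|z|.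
Proof.
rewrite normc_def lecR -sqrtr_sqr ler_sqrt ?addr_ge0 ?sqr_ge0 //.
by rewrite lerDr sqr_ge0.
Qed.

(** With $E = e^a - 1 - a$, $c = \cos b - 1$ and $s = \sin b - b$, the real and
    imaginary parts of $e^{a + ib} - 1 - (a + ib)$ are $E \cos b + a c + c$ and
    $E \sin b + a \sin b + s$, and every summand is small compared to
    $|a| + |b|$. *)
Lemma cexp_remainder (eps a b : R) : 0 < eps -> eps <= 1 -> `|a| <= eps ->
  `|expR a - 1 - a| <= eps * `|a| -> `|cos b - 1| <= eps * `|b| ->
  `|sin b - b| <= eps * `|b| ->
  `|expR a * cos b - 1 - a| + `|expR a * sin b - b| <= eps * (2 * `|a| + 5 * `|b|).
Proof.
move=> e0 e1 ae; set E := expR a - 1 - a; set c := cos b - 1; set s := sin b - b => Ee ce se.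
have P : `|expR a * cos b - 1 - a| <= `|E| + `|a| * `|c| + `|c|.
  have -> : expR a * cos b - 1 - a = E * cos b + a * c + c by rewrite /E /c; ring.
  apply: le_trans (ler_normD _ _) _; rewrite lerD2r.
  apply: le_trans (ler_normD _ _) _; rewrite normrM lerD // ?normrM //.
  by rewrite ler_piMr // ler_norml cos_geN1 cos_le1.
have Q : `|expR a * sin b - b| <= `|E| + `|a| * (`|s| + `|b|) + `|s|.
  have -> : expR a * sin b - b = E * sin b + a * sin b + s by rewrite /E /s; ring.
  apply: le_trans (ler_normD _ _) _; rewrite lerD2r.
  apply: le_trans (ler_normD _ _) _; rewrite !normrM lerD //.
    by rewrite ler_piMr // ler_norml sin_geN1 sin_le1.
  rewrite ler_wpM2l //; have -> : sin b = s + b by rewrite /s; ring.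
  exact: ler_normD.
have b0 := normr_ge0 b; have a0 := normr_ge0 a.
have ac : `|a| * `|c| <= eps * `|b|.
  by rewrite (le_trans _ ce) // ler_piMl // (le_trans ae).
have asb : `|a| * (`|s| + `|b|) <= eps * (2 * `|b|).
  apply: ler_pM => //; first by rewrite addr_ge0.
  by rewrite mulr2n mulrDl mul1r lerD // (le_trans se) // ler_piMl.
lra.
Qed.

Lemma cexp_approx0 : linear_approx cexp 0 1.
Proof.
move=> e0; rewrite ltcE /= => /andP[/eqP e0i e0r].
have {e0i} : e0 = (re e0)%:C by case: e0 e0i {e0r} => a b /= ->.
move: (re e0) e0r => e e_gt0 ->.
(* 7 = 2 + 5, the constants of [cexp_remainder]. *)
pose eps := Num.min 1 (e / 7).
have eps0 : 0 < eps by rewrite lt_min ltr01 divr_gt0.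
have eps1 : eps <= 1 by rewrite ge_min lexx.
have epse : eps * 7 <= e by rewrite -ler_pdivlMr // ge_min lexx orbT.
clearbody eps.
have [d1 d10 d1P] := real_linear_approx0 (is_derive_expR 0) eps0.
have [d2 d20 d2P] := real_linear_approx0 (is_derive_cos 0) eps0.
have [d3 d30 d3P] := real_linear_approx0 (is_derive_sin 0) eps0.
pose d := Num.min eps (Num.min d1 (Num.min d2 d3)).
exists d%:C; first by rewrite ltcR !lt_min eps0 d10 d20 d30.
move=> h hd; rewrite add0r cexp0 mulr1.
have rE := normc_def h; set r := Num.sqrt _ in rE.
have ar : `|re h| <= r by rewrite -lecR -rE normc_ge_Re.
have br : `|im h| <= r by rewrite -lecR -rE im_le_normc.
move: hd; rewrite rE ltcR !lt_min => /and4P[re1 rd1 rd2 rd3].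
have := cexp_remainder (b := im h) eps0 eps1 (le_trans ar (ltW re1)).
have := d1P _ (le_lt_trans ar rd1); rewrite expR0 mulr1 => h1 /(_ h1).
have := d2P _ (le_lt_trans br rd2); rewrite cos0 sin0 oppr0 mulr0 subr0 => h2 /(_ h2).
have := d3P _ (le_lt_trans br rd3); rewrite cos0 sin0 mulr1 subr0 => h3 /(_ h3) hPQ.
have -> : cexp h - 1 - h =
    (expR (re h) * cos (im h) - 1 - re h) +i* (expR (re h) * sin (im h) - im h).
  case: h {hPQ rE r ar br re1 rd1 rd2 rd3 h1 h2 h3} => a b.
  by apply/eqP; rewrite eq_complex /= subr0 !eqxx.
apply: le_trans (normc_le_sum _ _) _.
have -> : e%:C * r%:C = (e * r)%:C.
  by apply/eqP; rewrite eq_complex /= !mulr0 !mul0r subr0 addr0 !eqxx.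
rewrite lecR; apply: le_trans hPQ _.
have r0 : 0 <= r by apply: le_trans ar.
apply: le_trans (_ : eps * 7 * r <= _); last by rewrite ler_wpM2r.
by rewrite -mulrA ler_wpM2l ?(ltW eps0) //; lra.
Qed.

(** By the functional equation the increment of $e^{\lambda t}$ at [s] is
    $e^{\lambda s}$ times the increment at 0. *)
Lemma is_derive_cexp (lam s : R[i]) :
  is_derive (s : R[i]^o) (1 : R[i]^o) (fun t : R[i]^o => cexp (lam * t) : R[i]^o)
    (lam * cexp (lam * s)).
Proof.
apply: approx_is_derive => e e0.
have [c0|c0] := eqVneq (lam * cexp (lam * s)) 0.
  exists 1 => // h _; rewrite c0 mulr0 subr0 mulrDr cexpD.
  move/eqP: c0; rewrite mulf_eq0 => /orP[] /eqP ->.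
    by rewrite !mul0r cexp0 mulr1 subrr normr0 mulr_ge0 // ltW.
  by rewrite mul0r subrr normr0 mulr_ge0 // ltW.
move: (c0); rewrite mulf_eq0 negb_or => /andP[l0 E0].
have n0 : 0 < `|lam * cexp (lam * s)| by rewrite normr_gt0.
have [d d0 dP] := cexp_approx0 (divr_gt0 e0 n0).
exists (d / `|lam|); first by rewrite divr_gt0 // normr_gt0.
move=> h; rewrite ltr_pdivlMr ?normr_gt0 // mulrC -normrM => /dP.
rewrite add0r cexp0 mulr1 => hP.
have -> : cexp (lam * (s + h)) - cexp (lam * s) - h * (lam * cexp (lam * s)) =
   cexp (lam * s) * (cexp (lam * h) - 1 - lam * h) by rewrite mulrDr cexpD; ring.
rewrite normrM; apply: le_trans (ler_wpM2l (normr_ge0 _) hP) _.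
rewrite le_eqVlt; apply/orP; left; apply/eqP.
rewrite -normr_eq0 in l0; rewrite -normr_eq0 in E0; rewrite !normrM.
move: `|lam| `|cexp (lam * s)| `|h| l0 E0 => x y z x0 y0; field.
by rewrite x0 y0.
Qed.

End ComplexExponential.

(** * Completeness *)

Section Completeness.
Variables (R : realType) (n : nat).
Implicit Types (d : vecfield R[i] n).

Lemma is_derive_meval (gamma : R[i] -> 'I_n -> R[i]) (v : 'I_n -> R[i]) (s : R[i]) :
  (forall j, is_derive (s : R[i]^o) (1 : R[i]^o) (fun t : R[i]^o => gamma t j : R[i]^o) (v j)) ->
  forall q, is_derive (s : R[i]^o) (1 : R[i]^o) (fun t : R[i]^o => meval (gamma t) q : R[i]^o)
    (\sum_i meval (gamma s) (mderiv i q) * v i).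
Proof.
move=> dg; apply: mpoly_alg_ind => [c|k|p q hp hq|p q hp hq].
- have -> : (fun t : R[i]^o => meval (gamma t) (mpolyC n c)) = (fun=> c).
    by apply: funext => t; rewrite mevalC.
  by rewrite big1 => [|i _]; [exact: is_derive_cst|rewrite mderivC meval0 mul0r].
- have -> : (fun t : R[i]^o => meval (gamma t) (mpolyX _ (mnm1 k))) = (fun t => gamma t k).
    by apply: funext => t; rewrite mevalXU.
  rewrite (bigD1 k) //= mderiv_mX eqxx meval1 mul1r big1 ?addr0 // => i /negPf ik.
  by rewrite mderiv_mX eq_sym ik meval0 mul0r.
- have -> : (fun t : R[i]^o => meval (gamma t) (p + q)) =
      (fun t : R[i]^o => meval (gamma t) p : R[i]^o) + (fun t : R[i]^o => meval (gamma t) q : R[i]^o).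
    by apply: funext => t; rewrite mevalD.
  apply: (is_derive_eq (is_deriveD hp hq)); rewrite -big_split; apply: eq_bigr => i _.
  by rewrite mderivD mevalD mulrDl.
- have -> : (fun t : R[i]^o => meval (gamma t) (p * q)) =
      (fun t : R[i]^o => meval (gamma t) p : R[i]^o) * (fun t : R[i]^o => meval (gamma t) q : R[i]^o).
    by apply: funext => t; rewrite mevalM.
  apply: (is_derive_eq (is_deriveM hp hq)).
  rewrite !scaler_sumr -big_split; apply: eq_bigr => i _ /=.
  by rewrite mderivM mevalD !mevalM /GRing.scale /=; ring.
Qed.

(** The integral curves of the conjugate field are the images under [h] of those
    of [d]. *)
Lemma complete_conj (h g : 'I_n -> mpoly n R[i]) d :
  inverse_subst h g -> inverse_subst g h -> complete_vf d -> complete_vf (vf_conj h g d).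
Proof.
move=> hg gh cd p; have [gamma [g0 dg]] := cd (fun k => meval p (g k)).
exists (fun s k => meval (gamma s) (h k)); split=> [k|s k].
  rewrite (meval_eq _ (v2 := fun j => meval p (g j))) //.
  by rewrite -meval_psubst hg mevalXU.
rewrite ffunE meval_psubst.
rewrite (meval_eq _ (v2 := gamma s)); last by move=> j; rewrite -meval_psubst gh mevalXU.
apply: is_derive_eq (is_derive_meval (dg s) (h k)) _.
by rewrite /vf_apply raddf_sum; apply: eq_bigr => i _; rewrite /= mevalM mulrC.
Qed.

Lemma complete_diag_field (lam : 'I_n -> R[i]) : complete_vf (diag_field lam).
Proof.
move=> p; exists (fun s j => p j * cexp (lam j * s)); split=> [j|s j].
  by rewrite mulr0 cexp0 mulr1.
rewrite ffunE mevalZ mevalXU.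
apply: is_derive_eq; first exact: (is_deriveZ (p j) (is_derive_cexp (lam j) s)).
by rewrite /GRing.scale /=; ring.
Qed.

End Completeness.

Theorem theorem2 (R : realType) (n : nat) (hn : (2 <= n)%N)
    (delta : vecfield R[i] n) (delta_neq0 : delta != 0)
    (hdiv : ~ (exists c : R[i], vf_div delta = mpolyC n c)) :
  exists D : vecfield R[i] n,
    complete_vf D /\ generates_W [set delta; D].
Proof.
have char0 : [pchar R[i]] =i pred0 := pchar_num _.
pose good d := exists D : vecfield R[i] n, complete_vf D /\ generating_pair d D.
suff [D [cD genD]] : good delta.
  exists D; split=> //; apply/seteqP; split=> // v _ L [subL sL].
  by apply: genD => //; apply: sL; [left|right].
apply: (reduce_to_generic char0 (P := good)) => // [h g d hg gh [D [cD gen]]|d dgen dnc].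
  exists (vf_conj g h D); split; first exact: (complete_conj gh hg cD).
  exact: (generating_pair_conj hg gh gen).
have [lam lamP] := diagonal_generation char0 hn dgen dnc.
by exists (diag_field lam); split; [exact: complete_diag_field|exact: lamP].
Qed.
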